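(* Let $R_n$ be any bounded relaxation of $\mathrm{QAP}_n$ (a polytope in $\mathbb{R}^{n^2\times n^2}$ containing $\mathrm{QAP}_n$) such that all inequalities $$(\beta-1)\sum_{(ij)\in P\times Q}Y_{ij,ij}-\sum_{\substack{(ij),(kl)\in P\times Q\\ i<k}}Y_{ij,kl}\leqslant\frac{\beta^2-\beta}{2},$$ with $P,Q\subset[n]$ and integer $\beta$ satisfying (i) $\beta+1\leqslant|P|,|Q|\leqslant n-3$, (ii) $|P|+|Q|\leqslant n-3+\beta$, (iii) $\beta\geqslant2$, are valid for $R_n$. Then $\mathrm{xc}(R_n)\geqslant 2^{\Omega(n)}$.
   Context: $P_\sigma$ is the $n\times n$ permutation matrix of $\sigma\in S_n$ ($P_\sigma(i,j)=1$ iff $\sigma(i)=j$). Matrices in $\mathbb{R}^{n^2\times n^2}$ have rows and columns indexed by pairs $(ij)$, $i,j\in[n]$; $Y_{ij,kl}$ is the entry in row $(ij)$, column $(kl)$. $P^{[2]}_\sigma(ij,kl)=P_\sigma(i,j)P_\sigma(k,l)$ and $\mathrm{QAP}_n=\mathrm{conv}\{P^{[2]}_\sigma:\sigma\in S_n\}$. A polytope $Q\subset\mathbb{R}^{d+r}$ is an extension of a polytope $P\subset\mathbb{R}^d$ if $P=\{x:\exists y,\ (x,y)\in Q\}$; the extension complexity $\mathrm{xc}(P)$ is the minimum number of facets of an extension of $P$. *)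

(* Defs.v *)
From HB Require Import structures.
From mathcomp Require Export all_boot all_order all_fingroup all_algebra.
From mathcomp Require Export all_classical all_reals all_analysis.

Set Implicit Arguments.
Unset Strict Implicit.
Unset Printing Implicit Defensive.

Export Order.TTheory GRing.Theory Num.Theory.
Export numFieldNormedType.Exports.

#[global] Open Scope classical_set_scope.
#[global] Open Scope ring_scope.

Definition conv (R : realType) (V : lmodType R) (S : set V) : set V :=
  [set x | exists (m : nat) (p : 'I_m -> V) (a : 'I_m -> R),
     [/\ forall i, S (p i), forall i, 0 <= a i, \sum_i a i = 1
       & x = \sum_i a i *: p i]].

Section Polytopes.
Variables (R : realType) (d : nat).
Implicit Types (S F : set 'rV[R]_d).

Definition dot (a x : 'rV[R]_d) : R := (a *m x^T) 0 0.

Definition polyhedron S : Prop :=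
  exists (m : nat) (a : 'I_m -> 'rV[R]_d) (b : 'I_m -> R),
    S = [set x | forall i, dot (a i) x <= b i].

(* Boundedness is with respect to the library's (sup) norm on matrices. *)
Definition polytope S : Prop := polyhedron S /\ bounded_set S.

Definition affinely_independent (m : nat) (p : 'I_m -> 'rV[R]_d) : Prop :=
  forall a : 'I_m -> R,
    \sum_i a i = 0 -> \sum_i a i *: p i = 0 -> forall i, a i = 0.

(* The maximal number of affinely independent points of S, minus one; at most
   d + 1 points of R^d are affinely independent, so the bound on m loses
   nothing.  The empty set has dimension -1. *)
Definition affdim S : int :=
  (\max_(m < d.+2 | `[< exists p : 'I_m -> 'rV[R]_d,
                         (forall i, S (p i)) /\ affinely_independent p >]) m)%:Z
  - 1.

Definition face S F : Prop :=
  exists (a : 'rV[R]_d) (b : R),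
    (forall x, S x -> dot a x <= b) /\ F = [set x | S x /\ dot a x = b].

Definition facets S : set (set 'rV[R]_d) :=
  [set F | face S F /\ affdim F = affdim S - 1].

End Polytopes.

Definition extension (R : realType) (d r : nat)
    (P : set 'rV[R]_d) (Q : set 'rV[R]_(d + r)) : Prop :=
  polytope Q /\ P = [set x | exists y : 'rV[R]_r, Q (row_mx x y)].

Definition extension_sizes (R : realType) (d : nat) (P : set 'rV[R]_d) :
    set nat :=
  [set k | exists (r : nat) (Q : set 'rV[R]_(d + r)),
     extension P Q /\ (facets Q #= `I_k)%card].

(* The least element of [extension_sizes P].  The default value 0 is only used
   when P has no extension, which does not happen for a polytope: it is an
   extension of itself (r = 0) and has finitely many facets. *)
Definition xc (R : realType) (d : nat) (P : set 'rV[R]_d) : nat :=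
  xget 0%N [set k | extension_sizes P k /\
                    forall k', extension_sizes P k' -> (k <= k')%N].

Section QAP.
Variables (R : realType) (n : nat).

(* The index (ij) of R^(n^2) is [mxvec_index i j] : 'I_(n * n); the entry of
   [mxvec A] at this index is A i j.  Note perm_mx s i j = (s i == j)%:R. *)
Definition perm_mx2 (s : 'S_n) : 'M[R]_(n * n) :=
  \matrix_(p, q) (mxvec (perm_mx s) 0 p * mxvec (perm_mx s) 0 q).

Lemma perm_mx2E (s : 'S_n) (i j k l : 'I_n) :
  perm_mx2 s (mxvec_index i j) (mxvec_index k l) =
  (s i == j)%:R * (s k == l)%:R.
Proof. by rewrite mxE !mxvecE /perm_mx !mxE. Qed.

Definition QAP : set 'M[R]_(n * n) := conv (range perm_mx2).

Definition qap_ineq (P Q : {set 'I_n}) (beta : int) (Y : 'M[R]_(n * n)) :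
    Prop :=
  (beta%:~R - 1) *
    (\sum_(ij in finset.setX P Q)
       Y (mxvec_index ij.1 ij.2) (mxvec_index ij.1 ij.2))
  - \sum_(ij in finset.setX P Q) \sum_(kl in finset.setX P Q | (ij.1 < kl.1)%N)
      Y (mxvec_index ij.1 ij.2) (mxvec_index kl.1 kl.2)
  <= (beta%:~R ^+ 2 - beta%:~R) / 2.

Definition qap_cond (P Q : {set 'I_n}) (beta : int) : Prop :=
  [/\ beta + 1 <= #|P|%:Z <= n%:Z - 3,
      beta + 1 <= #|Q|%:Z <= n%:Z - 3,
      #|P|%:Z + #|Q|%:Z <= n%:Z - 3 + beta
    & 2 <= beta].

End QAP.

Arguments QAP : clear implicits.

(* Main.v *)
Require Import Defs.
From mathcomp Require Import lra ring zify.

(** Only [beta = 2] is needed. On the vertex of a permutation p the slack of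
    the inequality is C(t - 1, 2), where t is the number of i in P with p i
    in Q: it is 1 for t = 0 and 0 for t = 1. Encode a 0/1 vector s by a pair
    (P, Q), two disjoint copies of its support, and a 0/1 vector t by the
    permutation that exchanges the copies of i whenever t_i = 1; then the
    slack matrix contains unique disjointness, as the number of hits is the
    overlap of s and t. Let now E be an extension of the relaxation. Every
    face G of E is cut out by facets, so each facet F gives the rectangle of
    the pairs (s, t) with G_s inside F and the vertex of t outside F; these
    rectangles avoid overlap 1 and cover all 3^m disjoint pairs. A rectangle
    that avoids overlap 1 contains at most 2^m disjoint pairs (Kaibel and
    Weltz), so E has at least (3/2)^m facets. *)

Set Implicit Arguments.
Unset Strict Implicit.
Unset Printing Implicit Defensive.

(** * Unique disjointness *)

Definition overlap (s t : seq bool) : nat :=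
  count (fun p => p.1 && p.2) (zip s t).

Lemma overlap_nseq_false s m : overlap s (nseq m false) = 0%N.
Proof.
elim: s m => [|b s IH] [|m] //.
by rewrite /overlap /= -/(overlap _ _) IH andbF.
Qed.

Fixpoint disjoint_pairs (m : nat) : seq (seq bool * seq bool) :=
  if m is m'.+1 then
    let D := disjoint_pairs m' in
    [seq (false :: p.1, false :: p.2) | p <- D] ++
    [seq (true :: p.1, false :: p.2) | p <- D] ++
    [seq (false :: p.1, true :: p.2) | p <- D]
  else [:: ([::], [::])].

Lemma size_disjoint_pairs m : size (disjoint_pairs m) = (3 ^ m)%N.
Proof. by elim: m => //= m IH; rewrite !size_cat !size_map IH expnS; lia. Qed.

Lemma disjoint_pairsP m p : p \in disjoint_pairs m ->
  [/\ size p.1 = m, size p.2 = m & overlap p.1 p.2 = 0%N].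
Proof.
elim: m p => [|m IH] p /=; first by rewrite inE => /eqP ->.
by rewrite !mem_cat => /or3P[] /mapP[q /IH [s1 s2 o] ->] /=;
  rewrite /overlap /= s1 s2 -/(overlap _ _) o.
Qed.

(* Kaibel and Weltz: splitting on the first coordinate, the pairs counted on
   level m.+1 are dominated by those of the rectangles (A0 + A1) x B0 and
   A0 x (B0 + B1), since A1 x B1 contains no disjoint pair. *)
Lemma count_rectangle m (A B : pred (seq bool)) :
  (forall s t, size s = m -> size t = m -> A s -> B t -> overlap s t != 1%N) ->
  (count (fun p => A p.1 && B p.2) (disjoint_pairs m) <= 2 ^ m)%N.
Proof.
elim: m A B => [|m IH] A B AB /=; first by rewrite addn0; case: (_ && _).
rewrite !count_cat !count_map /=.
pose A0 s := A (false :: s); pose A1 s := A (true :: s).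
pose B0 s := B (false :: s); pose B1 s := B (true :: s).
have h1 : (count (fun p => (A0 p.1 || A1 p.1) && B0 p.2) (disjoint_pairs m)
           <= 2 ^ m)%N.
  apply: (IH (fun s => A0 s || A1 s) B0) => s t ss st /orP[] As Bt.
    by apply: (AB (false :: s) (false :: t)) => //=; rewrite ?ss ?st.
  by apply: (AB (true :: s) (false :: t)) => //=; rewrite ?ss ?st.
have h2 : (count (fun p => A0 p.1 && (B0 p.2 || B1 p.2)) (disjoint_pairs m)
           <= 2 ^ m)%N.
  apply: (IH A0 (fun s => B0 s || B1 s)) => s t ss st As /orP[] Bt.
    by apply: (AB (false :: s) (false :: t)) => //=; rewrite ?ss ?st.
  by apply: (AB (false :: s) (true :: t)) => //=; rewrite ?ss ?st.
rewrite expnS mul2n -addnn; apply: leq_trans (leq_add h1 h2).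
(* With [true] put in front of both vectors, a disjoint pair would get overlap exactly 1. *)
have h p : p \in disjoint_pairs m -> ~~ (A1 p.1 && B1 p.2).
  move=> /disjoint_pairsP[s1 s2 o]; apply/negP => /andP[a b].
  have := AB (true :: p.1) (true :: p.2).
  by rewrite /overlap /= s1 s2 -/(overlap _ _) o => /(_ erefl erefl a b).
elim: (disjoint_pairs m) h => //= p D IHD h.
have := IHD (fun q qD => h q (mem_behead (s := p :: D) qD)).
have := h p (mem_head _ _).
rewrite /A0 /A1 /B0 /B1; do 4 case: (_ (_ :: _)) => //=; lia.
Qed.

(** Double counting: each of the 3^m disjoint pairs lies in some rectangle, and each rectangle holds
    at most 2^m of them. *)
Lemma rectangle_cover_bound m k (A B : 'I_k -> pred (seq bool)) :
  (forall i s t, size s = m -> size t = m -> A i s -> B i t ->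
     overlap s t != 1%N) ->
  (forall s t, size s = m -> size t = m -> overlap s t = 0%N ->
     exists i, A i s && B i t) ->
  (3 ^ m <= k * 2 ^ m)%N.
Proof.
move=> AB cover; rewrite -size_disjoint_pairs.
have -> : (k * 2 ^ m = \sum_(i < k) 2 ^ m)%N by rewrite sum_nat_const card_ord.
pose N i := count (fun p => A i p.1 && B i p.2) (disjoint_pairs m).
have : (\sum_(i < k) N i <= \sum_(i < k) 2 ^ m)%N.
  by apply: leq_sum => i _; apply: count_rectangle => s t; apply: AB.
apply: leq_trans; rewrite /N.
under eq_bigr do rewrite -sum1_count big_mkcond.
rewrite exchange_big /= -sum1_size big_seq [X in (_ <= X)%N]big_seq.
apply: leq_sum => p /disjoint_pairsP[s1 s2 /(cover _ _ s1 s2)[i Hi]].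
by rewrite (bigD1 i) //= Hi.
Qed.

(** * Facets of polyhedra *)

Section Dot.
Variables (R : realType) (d : nat).
Implicit Types (a x y : 'rV[R]_d).

Lemma dotD a x y : dot a (x + y) = dot a x + dot a y.
Proof. by rewrite /dot linearD mulmxDr mxE. Qed.

Lemma dotZ a k x : dot a (k *: x) = k * dot a x.
Proof. by rewrite /dot linearZ -scalemxAr mxE. Qed.

Lemma dotB a x y : dot a (x - y) = dot a x - dot a y.
Proof. by rewrite -scaleN1r dotD dotZ mulN1r. Qed.

Lemma linear_form_dot (f : 'rV[R]_d -> R) :
  {morph f : x y / x + y} -> (forall k x, f (k *: x) = k * f x) ->
  exists c : 'rV[R]_d, forall x, f x = dot c x.
Proof.
move=> fD fZ; exists (\row_i f (delta_mx 0 i)) => x.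
have f0 : f 0 = 0 by rewrite -(scale0r 0) fZ mul0r.
rewrite {1}(row_sum_delta x) (big_morph f fD f0) /dot mxE.
by apply: eq_bigr => i _; rewrite fZ !mxE mulrC.
Qed.

End Dot.

Lemma dot_row_mx (R : realType) (d r : nat) (a x : 'rV[R]_d) (b y : 'rV[R]_r) :
  dot (row_mx a b) (row_mx x y) = dot a x + dot b y.
Proof. by rewrite /dot tr_row_mx mul_row_col mxE. Qed.

(** * Affine dimension as a matrix rank *)

Section AffineDimension.
Variables (R : realType) (d : nat).
Implicit Types (S : set 'rV[R]_d).

(** The extra coordinate 1 turns affine independence into linear independence, so dimensions can be
    bounded by ranks. *)
Definition homog (x : 'rV[R]_d) : 'rV[R]_(d + 1) := row_mx x (const_mx 1).

Definition homog_mx m (p : 'I_m -> 'rV[R]_d) : 'M[R]_(m, d + 1) :=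
  \matrix_i homog (p i).

Lemma mul_homog_mx m (p : 'I_m -> 'rV[R]_d) (u : 'rV[R]_m) :
  u *m homog_mx p =
  row_mx (\sum_i u 0 i *: p i) (const_mx (\sum_i u 0 i)).
Proof.
rewrite mulmx_sum_row; under eq_bigr => i _ do
  rewrite rowK scale_row_mx.
apply/rowP => j; rewrite summxE -(splitK j) /unsplit.
case: (fintype.split j) => k.
  by rewrite row_mxEl summxE; apply: eq_bigr => i _; rewrite row_mxEl.
by rewrite row_mxEr mxE; apply: eq_bigr => i _; rewrite row_mxEr !mxE mulr1.
Qed.

Lemma affinely_independentE m (p : 'I_m -> 'rV[R]_d) :
  affinely_independent p <-> row_free (homog_mx p).
Proof.
split=> [ind|free a sa sp i].
  apply/inj_row_free => u; rewrite mul_homog_mx => u0.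
  apply/rowP => i; rewrite mxE; apply: (ind (fun i => u 0 i)).
    have := congr1 (fun z => rsubmx z 0 0) u0.
    by rewrite row_mxKr !mxE.
  by have := congr1 lsubmx u0; rewrite row_mxKl linear0.
have u0 : (\row_i a i) *m homog_mx p = 0.
  rewrite mul_homog_mx.
  under eq_bigr do rewrite mxE; under [in const_mx _]eq_bigr do rewrite mxE.
  by rewrite sp sa; apply/rowP => j; rewrite !mxE; case: splitP => k; rewrite !mxE.
have /(row_free_inj free)/rowP/(_ i) :
    (\row_i a i) *m homog_mx p = 0 *m homog_mx p by rewrite u0 mul0mx.
by rewrite !mxE.
Qed.

(** A maximal free set of rows is an affinely independent subfamily; it has at most d + 1 members,
    within the range of the maximum in [affdim]. *)
Lemma affdim_ge_rank S m (p : 'I_m -> 'rV[R]_d) :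
  (forall i, S (p i)) -> (\rank (homog_mx p))%:Z - 1 <= affdim S.
Proof.
move=> Sp; rewrite lerD2r lez_nat.
have lt : (\rank (homog_mx p) < d.+2)%N.
  by rewrite ltnS (leq_trans (rank_leq_col _)) // addn1.
apply: (@leq_bigmax_cond _ _ (fun i : 'I_d.+2 => nat_of_ord i) (Ordinal lt)).
apply/asboolP; exists (p \o maxrankfun (homog_mx p)); split => [i|]; first exact: Sp.
apply/affinely_independentE; rewrite -/(homog_mx _).
have -> : homog_mx (p \o maxrankfun (homog_mx p)) =
          rowsub (maxrankfun (homog_mx p)) (homog_mx p).
  by apply/row_matrixP => i; rewrite row_rowsub !rowK.
exact: maxrowsub_free.
Qed.

Lemma affdim_attained S : exists (m : nat) (p : 'I_m -> 'rV[R]_d),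
  [/\ forall i, S (p i), \rank (homog_mx p) = m & affdim S = m%:Z - 1].
Proof.
rewrite /affdim.
have : (0 < #|[pred m : 'I_d.+2 | `[< exists p : 'I_m -> 'rV[R]_d,
   (forall i, S (p i)) /\ affinely_independent p >]]|)%N.
  apply/card_gt0P; exists ord0; apply/asboolP.
  by exists (fun=> 0); split=> [[]|a _ _ []].
case/(eq_bigmax_cond (fun i : 'I_d.+2 => nat_of_ord i)) => m; rewrite inE.
move=> [p [Sp /affinely_independentE/eqP ind]] E.
exists m, p; split => //.
by rewrite -[X in _ = X%:Z - 1]E.
Qed.

End AffineDimension.

(** * Faces, facets and relative interiors *)

Section Faces.
Variables (R : realType) (d : nat).
Implicit Types (Q S F : set 'rV[R]_d).

(** Lets a point move in any direction without breaking the constraints that are not tight there.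
    The sum of the ratios |ga i| / (be i - al i) stands in for their maximum, so one step length
    serves all i. *)
Lemma small_step (I : finType) (al be ga : I -> R) :
  exists2 e : R, 0 < e & forall i, al i < be i -> al i + e * ga i <= be i.
Proof.
pose f i := if al i < be i then `|ga i| / (be i - al i) else 0.
have f0 i : 0 <= f i.
  by rewrite /f; case: ifP => // h; rewrite divr_ge0 // subr_ge0 ltW.
have s0 : 0 <= \sum_i f i by apply: sumr_ge0.
exists (1 + \sum_i f i)^-1 => [|i h]; first by rewrite invr_gt0 ltr_wpDr.
rewrite -lerBrDl mulrC ler_pdivrMr ?ltr_wpDr //.
have fi : f i <= \sum_i f i by rewrite (bigD1 i) //= lerDl sumr_ge0.
have b0 : 0 < be i - al i by rewrite subr_gt0.
have h1 : `|ga i| <= (\sum_i f i) * (be i - al i).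
  by rewrite -ler_pdivrMr //; move: fi; rewrite {1}/f h.
have := ler_norm (ga i); nra.
Qed.

(** Averaging with a point where constraint j is strict makes j strict and keeps strict what was
    strict before; this is repeated over all constraints. *)
Lemma relative_interior_point S m (a : 'I_m -> 'rV[R]_d) (b : 'I_m -> R) x0 :
  S x0 -> (forall x y, S x -> S y -> S (2^-1 *: (x + y))) ->
  (forall i x, S x -> dot (a i) x <= b i) ->
  exists2 w, S w &
    forall i, (exists2 x, S x & dot (a i) x < b i) -> dot (a i) w < b i.
Proof.
move=> Sx0 mid le.
suff [w Sw h] : exists2 w, S w & forall i, i \in enum 'I_m ->
    (exists2 x, S x & dot (a i) x < b i) -> dot (a i) w < b i.
  by exists w => // i; apply: h; rewrite mem_enum.
elim: (enum 'I_m) => [|j s [w Sw IH]]; first by exists x0.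
have [[x Sx xj]|nx] := pselect (exists2 x, S x & dot (a j) x < b j); last first.
  by exists w => // i; rewrite inE => /predU1P[-> //|]; apply: IH.
exists (2^-1 *: (w + x)); first exact: mid.
move=> i; rewrite inE dotZ dotD => /predU1P[->|/IH h /h{}h].
  by move=> _; have := le j w Sw; lra.
by have := le i x Sx; lra.
Qed.

(** Walking from v through a relative interior point g of the face and beyond it breaks some
    constraint of an irredundant system. That constraint is tight at g, hence on the whole face, and
    strict at v; irredundancy makes it define a facet. *)
Lemma facet_separation Q (c : 'rV[R]_d) (delta : R) g0 v :
  polyhedron Q -> (forall x, Q x -> dot c x <= delta) ->
  Q g0 -> dot c g0 = delta -> Q v -> dot c v < delta ->
  exists2 F, facets Q F &
    (forall x, Q x -> dot c x = delta -> F x) /\ ~ F v.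
Proof.
move=> [m [a [b QE]]] cQ Qg0 cg0 Qv cv.
have Qle i x : Q x -> dot (a i) x <= b i by rewrite QE => /(_ i).
have Qmid x y : Q x -> Q y -> Q (2^-1 *: (x + y)).
  by move=> Qx Qy; rewrite QE => i; rewrite dotZ dotD;
    have := Qle i x Qx; have := Qle i y Qy; lra.
pose sys (J : {set 'I_m}) := [set x | forall i, i \in J -> dot (a i) x <= b i].
(* For a constraint i of an irredundant subsystem J, some point z violates
   i only; the segment from a relative interior point w to z then meets the
   hyperplane of i in a relative interior point y of the face of i. *)
have [J Jmin _] : {J | minset (fun J => `[< sys J = Q >]) J & J \subset [set: 'I_m]%SET}.
  apply: minset_exists; apply/asboolP; rewrite /sys QE; apply/seteqP.
  by split => x /= h i //; apply: h; rewrite finset.in_setT.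
have /asboolP JQ := minsetp Jmin.
pose G := [set x | Q x /\ dot c x = delta].
have Gmid x y : G x -> G y -> G (2^-1 *: (x + y)).
  move=> [Qx cx] [Qy cy]; split; first exact: Qmid.
  by rewrite dotZ dotD cx cy; lra.
have [g [Qg cg] gint] := @relative_interior_point G m a b g0 (conj Qg0 cg0)
  Gmid (fun i x Gx => Qle i x Gx.1).
(* The form c exceeds delta beyond g, so the new point is outside Q; the step is too short to break
   a constraint that is not tight at g. *)
have [e e0 he] := small_step (fun i => dot (a i) g) b (fun i => dot (a i) (g - v)).
have [i iJ ai] : exists2 i, i \in J & b i < dot (a i) (g + e *: (g - v)).
  apply: contrapT => no.
  have : Q (g + e *: (g - v)).
    rewrite -JQ => i iJ; rewrite leNgt; apply/negP => h; apply: no.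
    by exists i.
  move/cQ; rewrite dotD dotZ dotB cg; nra.
have gi : dot (a i) g = b i.
  apply/eqP; rewrite eq_le Qle //= leNgt; apply/negP => /he.
  by rewrite -dotZ -dotD leNgt ai.
have vi : dot (a i) v < b i by move: ai; rewrite dotD dotZ dotB gi; nra.
pose F := [set x | Q x /\ dot (a i) x = b i].
have GF x : Q x -> dot c x = delta -> F x.
  move=> Qx cx; split => //; apply/eqP; rewrite eq_le Qle //= leNgt.
  apply/negP => xi; have := gint i; rewrite gi ltxx => h.
  by have := h (ex_intro2 _ _ x (conj Qx cx) xi).
exists F; last by split => // -[_ vb]; move: vi; rewrite vb ltxx.
have [w Qw wint] := relative_interior_point Qv Qmid Qle.
have wi := wint i (ex_intro2 _ _ v Qv vi).
have [z zJ zi] : exists2 z, (forall j, j \in J -> j != i -> dot (a j) z <= b j)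
    & b i < dot (a i) z.
  apply: contrapT => no.
  have : sys (J :\ i)%SET = Q.
    rewrite -JQ; apply/seteqP; split => x /= h j; last first.
      by rewrite in_setD1 => /andP[_]; exact: h.
    move=> jJ; have [->|ji] := eqVneq j i; last by apply: h; rewrite in_setD1 ji.
    rewrite leNgt; apply/negP => xi; apply: no; exists x => // k kJ ki.
    by apply: h; rewrite in_setD1 ki.
  move/asboolP => P'; have := minsetinf Jmin P' (subsetDl _ _).
  by move/setP/(_ i); rewrite in_setD1 eqxx iJ.
pose l := (b i - dot (a i) w) / (dot (a i) z - dot (a i) w).
have dz : 0 < dot (a i) z - dot (a i) w by lra.
have l0 : 0 < l by rewrite /l divr_gt0 // subr_gt0.
have l1 : l < 1 by rewrite /l ltr_pdivrMr //; lra.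
pose y := w + l *: (z - w).
have yi : dot (a i) y = b i.
  by rewrite dotD dotZ dotB /l divfK ?gt_eqF //; lra.
have Qy : Q y.
  rewrite -JQ => j jJ; have [->|ji] := eqVneq j i; first by rewrite yi.
  rewrite dotD dotZ dotB; have := zJ j jJ ji; have := Qle j w Qw; nra.
have yint j : j \in J -> j != i -> (exists2 x, Q x & dot (a j) x < b j) ->
    dot (a j) y < b j.
  move=> jJ ji /wint wj; rewrite dotD dotZ dotB; have := zJ j jJ ji; nra.
split; first by exists (a i), (b i); split => // x; apply: Qle.
(* Upper bound on the dimension of F: v is off the hyperplane of i, so it extends every affinely
   independent family of F. *)
apply/eqP; rewrite eq_le; apply/andP; split.
  have [k [p [Fp rp ->]]] := affdim_attained F.
  pose p' (j : 'I_(k + 1)) :=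
    match fintype.split j with inl j' => p j' | inr _ => v end.
  have Qp' j : Q (p' j) by rewrite /p'; case: (fintype.split j) => // j'; case: (Fp j').
  rewrite lerD2r; apply: le_trans (_ : (k + 1)%N%:Z - 1 <= _); first by rewrite -subr_ge0; lia.
  suff <- : \rank (homog_mx p') = (k + 1)%N by exact: affdim_ge_rank.
  apply/eqP; rewrite -/(row_free _); apply/affinely_independentE => u su sp.
  have {}rp : affinely_independent p by apply/affinely_independentE; rewrite /row_free rp.
  move: su sp; rewrite !big_split_ord !big_ord1 /=.
  have p'l (j : 'I_k) : p' (lshift 1 j) = p j.
    by rewrite /p' (unsplitK (inl _ j)).
  have p'r (j : 'I_1) : p' (rshift k j) = v.
    by rewrite /p' (unsplitK (inr _ j)).
  have -> : \sum_(j < k) u (lshift 1 j) *: p' (lshift 1 j) =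
      \sum_(j < k) u (lshift 1 j) *: p j by apply: eq_bigr => j _; rewrite p'l.
  rewrite p'r => su sp.
  have uv : u (rshift k ord0) = 0.
    have : dot (a i) (\sum_(j < k) u (lshift 1 j) *: p j + u (rshift k ord0) *: v) = 0.
      by rewrite sp -(scale0r 0) dotZ mul0r.
    have -> : dot (a i) (\sum_(j < k) u (lshift 1 j) *: p j + u (rshift k ord0) *: v)
       = (\sum_(j < k) u (lshift 1 j)) * b i + u (rshift k ord0) * dot (a i) v.
      rewrite dotD dotZ; congr (_ + _); rewrite mulr_suml.
      have -> : dot (a i) (\sum_(j < k) u (lshift 1 j) *: p j) =
          \sum_(j < k) dot (a i) (u (lshift 1 j) *: p j).
        apply: (big_morph (dot (a i)) (dotD (a i))).
        by rewrite -(scale0r 0) dotZ mul0r.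
      by apply: eq_bigr => j _; rewrite dotZ; have [_ ->] := Fp j.
    move/eqP: su; rewrite addr_eq0 => /eqP ->; rewrite mulNr -mulrN -mulrDr addrC.
    by move/eqP; rewrite mulf_eq0 => /orP[/eqP //|]; rewrite subr_eq0 lt_eqF.
  move: su sp; rewrite uv scale0r !addr0 => su sp j.
  rewrite -(splitK j) /unsplit; case: (fintype.split j) => j'.
    exact: (rp (fun j => u (lshift 1 j))).
  by rewrite ord1 uv.
(* Lower bound: [pr] projects along y - w onto the hyperplane of i, a change of the homogenised
   matrix by rank at most one; contracting towards y then brings the images into F. *)
have [k [p [Qp rp ->]]] := affdim_attained Q.
pose phi x := (b i - dot (a i) x) / (b i - dot (a i) w).
pose pr x := x + phi x *: (y - w).
have bw : b i - dot (a i) w != 0 by rewrite subr_eq0 gt_eqF.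
have pri x : dot (a i) (pr x) = b i.
  by rewrite dotD dotZ dotB yi /phi divfK //; lra.
have shrink x : Q x -> exists e, e != 0 /\ F (y + e *: (pr x - y)).
  move=> Qx.
  have [s s0 hs] := small_step (fun j => dot (a j) y) b (fun j => dot (a j) (pr x - y)).
  exists s; split; first by rewrite gt_eqF.
  split; last by rewrite dotD dotZ dotB pri yi; lra.
  rewrite -JQ => j jJ; have [->|ji] := eqVneq j i.
    by rewrite dotD dotZ dotB pri yi; lra.
  have [/(yint j jJ ji)/hs|nj] := pselect (exists2 x, Q x & dot (a j) x < b j).
    by move=> h; rewrite dotD dotZ.
  (* A constraint nowhere strict on Q is tight at x, y and w, hence on the whole line through y and
     [pr x]. *)
  have tight u : Q u -> dot (a j) u = b j.
    move=> Qu; apply/eqP; rewrite eq_le Qle //= leNgt; apply/negP => uj.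
    by apply: nj; exists u.
  by rewrite dotD dotZ dotB /pr dotD dotZ dotB !tight //; lra.
have [e' he'] := choice (fun j => shrink (p j) (Qp j)).
pose p' (j : 'I_(k + 1)) := match fintype.split j with
  inl j' => y + e' j' *: (pr (p j') - y) | inr _ => y end.
have Fp' j : F (p' j).
  by rewrite /p'; case: (fintype.split j) => // j'; case: (he' j').
have := affdim_ge_rank Fp'; apply: le_trans.
(* An affine combination with y, the last point of [p'], undoes the contraction. *)
have sub : (homog_mx (fun j => pr (p j)) <= homog_mx p')%MS.
  apply/row_subP => j; rewrite rowK.
  have -> : homog (pr (p j)) = (e' j)^-1 *: homog (p' (lshift 1 j)) +
      (1 - (e' j)^-1) *: homog (p' (rshift k 0)).
    rewrite /p' (unsplitK (inl _ j)) (unsplitK (inr _ _)) /homog !scale_row_mx.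
    rewrite add_row_mx; congr row_mx; last first.
      by apply/rowP => ?; rewrite !mxE; lra.
    apply/rowP => q; rewrite !mxE; have [e'0 _] := he' j; by field.
  rewrite addmx_sub // scalemx_sub //.
    by rewrite (_ : homog _ = row (lshift 1 j) (homog_mx p')) ?row_sub // rowK.
  by rewrite (_ : homog _ = row (rshift k 0) (homog_mx p')) ?row_sub // rowK.
have r1 : (k <= \rank (homog_mx (fun j => pr (p j))) + 1)%N.
  rewrite -{1}rp.
  have -> : homog_mx p = homog_mx (fun j => pr (p j)) +
      (\col_j - phi (p j)) *m row_mx (y - w) 0.
    apply/row_matrixP => j; rewrite linearD /= row_mul !rowK.
    rewrite (_ : row j _ = (- phi (p j))%:M); last first.
      by apply/rowP => q; rewrite ord1 !mxE eqxx.
    rewrite mul_scalar_mx scale_row_mx scaler0 /homog add_row_mx addr0.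
    by rewrite scaleNr addrK.
  apply: leq_trans (mxrank_add _ _) _; rewrite leq_add2l.
  exact: leq_trans (mxrankM_maxr _ _) (rank_leq_row _).
have := mxrankS sub.
rewrite -lez_nat; move: r1; rewrite -lez_nat PoszD => r1 r2.
by rewrite lerD2r lerBlDr (le_trans r1) // lerD2r.
Qed.

(** A nonempty face is recovered from the set of constraints tight at one of its relative interior
    points; [None] stands for the empty face. *)
Lemma finite_facets Q : polyhedron Q -> finite_set (facets Q).
Proof.
move=> [m [a [b QE]]].
have Qle i x : Q x -> dot (a i) x <= b i by rewrite QE => /(_ i).
pose f (J : option {set 'I_m}) : set 'rV[R]_d := if J is Some J' then
  [set x | Q x /\ forall i, i \in J' -> dot (a i) x = b i] else set0.
apply: (@sub_finite_set _ _ (range f)); last first.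
  by apply: finite_image; exact: finite_finset.
move=> F [[c [delta [cQ FE]]] _].
have [[x0 Fx0]|no] := pselect (exists x, F x); last first.
  exists None => //=; apply/esym/seteqP; split => // x Fx; apply: no; by exists x.
have Fmid x y : F x -> F y -> F (2^-1 *: (x + y)).
  rewrite FE => -[Qx cx] [Qy cy]; split; last by rewrite dotZ dotD cx cy; lra.
  by rewrite QE => i; rewrite dotZ dotD;
    have := Qle i x Qx; have := Qle i y Qy; lra.
have FQ x : F x -> Q x by rewrite FE => -[].
have [w Fw wint] := relative_interior_point Fx0 Fmid (fun i x Fx => Qle i x (FQ x Fx)).
exists (Some [set i | dot (a i) w == b i]%SET) => //=.
apply/seteqP; split => x /=.
  move=> [Qx xt]; rewrite FE; split => //; apply/eqP; rewrite eq_le cQ //=.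
  (* The segment from x to w can be prolonged a little beyond w inside Q. As c is maximal at w, it
     cannot be smaller at x. *)
  have [e e0 he] := small_step (fun i => dot (a i) w) b (fun i => dot (a i) (w - x)).
  have : Q (w + e *: (w - x)).
    rewrite QE => i /=; rewrite dotD dotZ.
    have [wi|wi] := eqVneq (dot (a i) w) (b i).
      by rewrite dotB xt ?inE ?wi //; lra.
    by apply: he; rewrite lt_neqAle wi Qle //; exact: FQ.
  move: Fw; rewrite FE => -[_ cw] /cQ; rewrite dotD dotZ dotB cw; nra.
move=> Fx; have Qx := FQ x Fx; split=> // i; rewrite inE => /eqP wi.
apply/eqP; rewrite eq_le Qle //= leNgt.
apply/negP => xi; have := wint i; rewrite wi ltxx => h.
by have := h (ex_intro2 _ _ x Fx xi).
Qed.

End Faces.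

(** * Attainment of the extension complexity *)

Lemma self_extension (R : realType) (d : nat) (P : set 'rV[R]_d) :
  polytope P -> exists Q : set 'rV[R]_(d + 0), extension P Q.
Proof.
move=> [[m [a [b PE]]] bP].
exists [set z | P (lsubmx z)]; split; last first.
  apply/seteqP; split => x /=; first by move=> Px; exists 0; rewrite row_mxKl.
  by move=> [y]; rewrite row_mxKl.
split.
  exists m, (fun i => row_mx (a i) 0), b; apply/seteqP; split => z /=.
    move=> Pz i; rewrite -(hsubmxK z) dot_row_mx {2}/dot mul0mx mxE addr0.
    by move: Pz; rewrite PE; apply.
  move=> h; rewrite PE => i; have := h i.
  by rewrite -{1}(hsubmxK z) dot_row_mx {2}/dot mul0mx mxE addr0.
case: bP => M [Mr hM]; exists M; split => // x Mx z Pz.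
(* [d + 0] and [d] are only provably equal, so the norms are compared by transport along that
   equality. *)
have norm_z : `|z| = `|lsubmx z|.
  have E : forall k (e : d = k) (u : 'rV[R]_k),
      `|u| = `|\row_i u 0 (cast_ord e i)|.
    by move=> k e; case: k / e => u; congr (`|_|); apply/rowP => i;
      rewrite mxE cast_ord_id.
  rewrite (E _ (esym (addn0 d))); congr (`|_|); apply/rowP => i.
  by rewrite !mxE; congr (z _ _); apply: val_inj.
by rewrite /= norm_z; exact: (hM x Mx (lsubmx z) Pz).
Qed.

Lemma xc_extension_size (R : realType) (d : nat) (P : set 'rV[R]_d) :
  polytope P -> extension_sizes P (xc P).
Proof.
move=> polP.
suff [k [Pk kmin]] : exists k, extension_sizes P k /\
    forall k', extension_sizes P k' -> (k <= k')%N.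
  by rewrite /xc; case: xgetP => [y -> []//|/(_ k)[]].
have [Q QP] := self_extension polP.
have /finite_setP[k0 Qk0] := finite_facets QP.1.1.
have ex : exists k, `[< extension_sizes P k >].
  by exists k0; apply/asboolP; exists 0%N, Q.
case: (ex_minnP ex) => k /asboolP Pk kmin.
by exists k; split => // k' Pk'; apply: kmin; apply/asboolP.
Qed.

(** * The QAP slack matrix *)

Section Swaps.
Variable n : nat.
Implicit Types (s t : seq bool).

Definition swap_nat s (i : nat) : nat :=
  if nth false s i then (i + size s)%N
  else if (size s <= i)%N && nth false s (i - size s)%N then (i - size s)%N
  else i.

Definition swap_ord s (i : 'I_n) : 'I_n := insubd i (swap_nat s i).

Lemma nth_true_lt s i : nth false s i -> (i < size s)%N.
Proof.
move=> si; rewrite ltnNge; apply/negP => /(nth_default false) E.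
by rewrite E in si.
Qed.

Lemma swap_nat_lt s i : ((size s).*2 <= n)%N -> (i < n)%N -> (swap_nat s i < n)%N.
Proof.
rewrite /swap_nat => sn ltin; case: ifP => [/nth_true_lt|_]; first by lia.
by case: ifP => // _; lia.
Qed.

Lemma swap_natK s : involutive (swap_nat s).
Proof.
move=> i; rewrite /swap_nat; case: (boolP (nth false s i)) => [si|nsi].
  have lti := nth_true_lt si.
  by rewrite nth_default ?leq_addl //= addnK si.
case: (boolP (_ && _)) => [/andP[lei si]|h]; first by rewrite si subnK.
by rewrite (negPf nsi) (negPf h).
Qed.

Lemma val_swap_ord s i : ((size s).*2 <= n)%N ->
  val (swap_ord s i) = swap_nat s i.
Proof. by move=> sn; rewrite val_insubd swap_nat_lt. Qed.

Lemma swap_ord_inj s : ((size s).*2 <= n)%N -> injective (swap_ord s).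
Proof.
move=> sn; apply: inv_inj => i; apply: val_inj.
by rewrite !val_swap_ord // swap_natK.
Qed.

(* Exchanges i and i + size s for all i with s_i = true; the junk value 1 is
   taken only when size s > n / 2. *)
Definition swap_perm s : 'S_n :=
  match pselect (injective (swap_ord s)) with
  | left inj => perm inj
  | right _ => 1%g
  end.

Lemma swap_permE s i : ((size s).*2 <= n)%N ->
  val (swap_perm s i) = swap_nat s i.
Proof.
move=> sn; rewrite /swap_perm; case: pselect => [inj|[]]; last exact: swap_ord_inj.
by rewrite permE val_swap_ord.
Qed.

Definition support_set s : {set 'I_n} := [set i : 'I_n | nth false s i]%SET.

(** When 2 * size s <= n, the swap is an involution and this is the support moved up by [size s]. As
    a preimage under a permutation it visibly has the size of the support. *)
Definition shifted_set s : {set 'I_n} := (swap_perm s @^-1: support_set s)%SET.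

Lemma card_shifted_set s : #|shifted_set s| = #|support_set s|.
Proof. by rewrite card_preimset //; exact: perm_inj. Qed.

Lemma card_overlap s t : size s = size t -> (size s <= n)%N ->
  #|[set i : 'I_n | nth false s i && nth false t i]%SET| = overlap s t.
Proof.
move=> st sn; rewrite -sum1_card; under eq_bigl do rewrite inE.
rewrite big_mkcond /=.
elim: s t n st sn => [|b s IH] [|c t] k //= st.
  by move=> _; rewrite big1 // => i _; rewrite nth_nil.
case: k => // k ltk; case: st => st; by rewrite big_ord_recl /= IH //.
Qed.

Lemma card_support_set s : (size s <= n)%N -> #|support_set s| = count id s.
Proof.
move=> sn; have := card_overlap (erefl (size s)) sn.
have -> : [set i : 'I_n | nth false s i && nth false s i]%SET = support_set s.
  by apply/setP => i; rewrite !inE andbb.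
by move=> ->; rewrite /overlap; elim: s {sn} => //= b s ->; rewrite andbb.
Qed.

Definition hits (p : 'S_n) (P Q : {set 'I_n}) : {set 'I_n} :=
  [set i in P | p i \in Q]%SET.

(** Let s_i be true. If t_i is true, i goes to i + size s, which lies in the shifted set; otherwise
    i stays below [size s], where the shifted set has no element. *)
Lemma card_hits_swap s t : size s = size t -> ((size s).*2 <= n)%N ->
  #|hits (swap_perm t) (support_set s) (shifted_set s)| = overlap s t.
Proof.
move=> st sn; rewrite -card_overlap //; last by lia.
congr #|pred_of_set _|; apply/setP => i; rewrite !inE.
case: (boolP (nth false s i)) => //= si; have lti := nth_true_lt si.
rewrite swap_permE // swap_permE -?st //.
have -> : swap_nat t i = if nth false t i then (i + size s)%N else i.
  rewrite /swap_nat -st; case: ifP => // _.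
  by rewrite leqNgt lti.
case: (nth false t i).
  by rewrite /swap_nat (nth_default _ (leq_addl _ _)) leq_addl addnK si.
by rewrite /swap_nat si nth_default // leq_addl.
Qed.

End Swaps.

(** * Values of the inequality at permutations *)

Section Form.
Variables (R : realType) (n : nat).
Implicit Types (P Q : {set 'I_n}).

(* The left-hand side of the inequality for beta = 2. *)
Definition qap_form P Q (Y : 'M[R]_(n * n)) : R :=
  \sum_(ij in finset.setX P Q)
     Y (mxvec_index ij.1 ij.2) (mxvec_index ij.1 ij.2)
  - \sum_(ij in finset.setX P Q) \sum_(kl in finset.setX P Q | (ij.1 < kl.1)%N)
      Y (mxvec_index ij.1 ij.2) (mxvec_index kl.1 kl.2).

Lemma qap_ineq2 P Q Y : qap_ineq P Q 2 Y <-> qap_form P Q Y <= 1.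
Proof.
rewrite /qap_ineq -/(qap_form P Q Y).
have -> : (2%:~R - 1 : R) = 1 by rewrite -[2%:~R]/(1 + 1 : R) addrK.
have -> : ((2%:~R ^+ 2 - 2%:~R) / 2 : R) = 1 by rewrite -[2%:~R]/(2 : R); lra.
by rewrite mul1r.
Qed.

Lemma qap_form_dot P Q :
  exists c : 'rV[R]_((n * n) * (n * n)), forall Y, qap_form P Q Y = dot c (mxvec Y).
Proof.
have [||c cE] := @linear_form_dot R _ (fun x => qap_form P Q (vec_mx x)).
- move=> x y; rewrite /qap_form linearD /= addrACA -opprD; congr (_ + _).
    by rewrite -big_split; apply: eq_bigr => i _; rewrite mxE.
  congr (- _); rewrite -big_split; apply: eq_bigr => i _.
  by rewrite -big_split; apply: eq_bigr => j _; rewrite mxE.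
- move=> k x; rewrite /qap_form linearZ /= mulrBr !mulr_sumr; congr (_ - _).
    by apply: eq_bigr => i _; rewrite mxE.
  apply: eq_bigr => i _; rewrite mulr_sumr.
  by apply: eq_bigr => j _; rewrite mxE.
by exists c => Y; rewrite -cE mxvecK.
Qed.

(** The first sum counts the hits. A nonzero term of the second would need two hits i < k. *)
Lemma qap_form_perm P Q (p : 'S_n) : (#|hits p P Q| <= 1)%N ->
  qap_form P Q (perm_mx2 R p) = #|hits p P Q|%:R.
Proof.
move=> le1; rewrite /qap_form [X in _ - X]big1 ?subr0; last first.
  move=> [i j]; rewrite inE /= => /andP[iP jQ].
  apply: big1 => -[k l] /=; rewrite inE /= => /andP[/andP[kP lQ] ltik].
  rewrite perm_mx2E; case: eqP => [pi|_]; last by rewrite mul0r.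
  case: eqP => [pk|_]; last by rewrite mulr0.
  have ik : i = k by apply: (card_le1_eqP le1); rewrite inE ?iP ?kP ?pi ?pk.
  by move: ltik; rewrite ik ltnn.
transitivity (\sum_(i in P) \sum_(j in Q) (p i == j)%:R : R).
  rewrite pair_big_dep /=; apply: eq_big => [[i j]|[i j] _] /=; first by rewrite inE.
  by rewrite perm_mx2E; case: eqP; rewrite ?mul1r ?mul0r.
rewrite -sum1_card natr_sum; under [RHS]eq_bigl do rewrite inE.
rewrite [RHS]big_mkcondr /=; apply: eq_bigr => i iP.
case: ifP => pQ.
  rewrite (bigD1 (p i)) //= eqxx big1 ?addr0 // => j /andP[_].
  by rewrite eq_sym => /negPf ->.
by apply: big1 => j jQ; case: eqP => // E; rewrite -E pQ in jQ.
Qed.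

End Form.

(** * From extensions to rectangle covers *)

Lemma perm_mx2_QAP (R : realType) (n : nat) (p : 'S_n) : QAP R n (perm_mx2 R p).
Proof.
exists 1%N, (fun=> perm_mx2 R p), (fun=> 1); split => //.
- by rewrite big_ord1.
- by rewrite big_ord1 scale1r.
Qed.

Lemma extension_size_bound (R : realType) (n m k : nat) (Rn : set 'M[R]_(n * n)) :
  ((m + 3).*2 < n)%N -> QAP R n `<=` Rn ->
  (forall (P Q : {set 'I_n}) (beta : int), qap_cond P Q beta ->
     forall Y : 'M[R]_(n * n), Rn Y -> qap_ineq P Q beta Y) ->
  extension_sizes (mxvec @` Rn) k -> (3 ^ m <= k * 2 ^ m)%N.
Proof.
move=> mn QR valid [r [Q [[[polQ _] proj] card]]].
have lift p : exists y, Q (row_mx (mxvec (perm_mx2 R p)) y).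
  have : (mxvec @` Rn) (mxvec (perm_mx2 R p)).
    by exists (perm_mx2 R p) => //; apply: QR; apply: perm_mx2_QAP.
  by rewrite proj.
have {lift}[y Qy] := choice lift.
pose v p := row_mx (mxvec (perm_mx2 R p)) (y p).
(* The padding ensures |P| >= 3 and that no face is empty (see g below). *)
pose row_pad (s : seq bool) := [:: true, true, true & s].
pose col_pad (t : seq bool) := [:: false, false, false & t].
pose P s := support_set n (row_pad s); pose P' s := shifted_set n (row_pad s).
have [c cE] := choice (fun s => @qap_form_dot R n (P s) (P' s)).
(* Weight zero on the additional coordinates lifts the form to the extension. *)
pose c' s := row_mx (c s) (0 : 'rV[R]_r).
have c'v s p : dot (c' s) (v p) = qap_form (P s) (P' s) (perm_mx2 R p).
  by rewrite dot_row_mx cE {2}/dot mul0mx mxE addr0.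
have c'Q s z : size s = m -> Q z -> dot (c' s) z <= 1.
  move=> ss Qz.
  have : (mxvec @` Rn) (lsubmx z) by rewrite proj; exists (rsubmx z); rewrite hsubmxK.
  move=> [Y RY Yz]; rewrite -(hsubmxK z) dot_row_mx {2}/dot mul0mx mxE addr0 -Yz -cE.
  apply/qap_ineq2; apply: valid RY.
  have cP : #|P s| = (count id s + 3)%N.
    by rewrite card_support_set /=; lia.
  have cP' : #|P' s| = #|P s| by rewrite card_shifted_set.
  have := count_size id s; rewrite ss => cs.
  (* The padding yields |P| >= 3 = beta + 1. Condition (ii) reads 2|P| <= n - 1 and follows from |P|
     <= m + 3 and the bound on n. *)
  by split; rewrite ?cP' ?cP; lia.
have tight s t : size s = m -> size t = m -> (overlap s t <= 1)%N ->
    dot (c' s) (v (swap_perm n (col_pad t))) = (overlap s t)%:R.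
  move=> ss st le1; rewrite c'v.
  have h : #|hits (swap_perm n (col_pad t)) (P s) (P' s)| = overlap s t.
    by rewrite card_hits_swap //=; lia.
  by rewrite qap_form_perm h.
have [f [fF _ fsurj]] : exists f : nat -> set 'rV[R]_(_ + r), set_bij `I_k (facets Q) f.
  by apply/card_set_bijP; rewrite card_eq_sym.
pose A (i : 'I_k) s := `[< forall z, Q z -> dot (c' s) z = 1 -> f i z >].
pose B (i : 'I_k) t := ~~ `[< f i (v (swap_perm n (col_pad t))) >].
(* Overlap 1 would put the lifted vertex of t on the face of s, hence in every facet containing that
   face. *)
apply: (@rectangle_cover_bound m k A B) => [i s t ss st /asboolP As /asboolP Bt|].
  apply/eqP => o1; apply: Bt; apply: As; first exact: Qy.
  by rewrite tight // o1.
move=> s t ss st o0.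
(* Its only [true] meets the padding of the row vector, so there is exactly one hit whatever s
   is. *)
pose g := v (swap_perm n [:: true, false, false & nseq m false]).
have cg : dot (c' s) g = 1.
  rewrite c'v.
  have h : #|hits (swap_perm n [:: true, false, false & nseq m false]) (P s) (P' s)| = 1%N.
    rewrite card_hits_swap /= ?size_nseq ?ss //; last by lia.
    by rewrite /overlap /= -/(overlap _ _) overlap_nseq_false.
  by rewrite qap_form_perm h.
have vlt : dot (c' s) (v (swap_perm n (col_pad t))) < 1.
  by rewrite tight ?o0 // ltr01.
have [F FQ [GF nFv]] := facet_separation polQ (fun z => c'Q s z ss) (Qy _) cg (Qy _) vlt.
have [i ik fi] := fsurj F FQ.
exists (Ordinal ik); apply/andP; split; first by apply/asboolP; rewrite /= fi.
by apply/asboolP; rewrite /= fi.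
Qed.

Theorem theorem8 (R : realType) :
  exists c : R, 0 < c /\ exists n0 : nat,
    forall (n : nat) (Rn : set 'M[R]_(n * n)),
      (n0 <= n)%N ->
      polytope (mxvec @` Rn) ->
      QAP R n `<=` Rn ->
      (forall (P Q : {set 'I_n}) (beta : int), qap_cond P Q beta ->
         forall Y : 'M[R]_(n * n), Rn Y -> qap_ineq P Q beta Y) ->
      2 `^ (c * n%:R) <= (xc (mxvec @` Rn))%:R.
Proof.
exists (1 / 16); split; first by rewrite divr_gt0.
exists 16%N => n Rn n16 pol QR valid.
(* Taking m = 2q turns the bound (3/2)^m into (9/4)^q >= 2^q, and n >= 16 ensures both 4q + 6 < n
   and n / 16 <= q. *)
pose q := (n %/ 8)%N.
have size_n : ((2 * q + 3).*2 < n)%N by lia.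
have := extension_size_bound size_n QR valid (xc_extension_size pol).
set k := xc _ => bound.
have qk : (2 ^ q <= k)%N.
  (* If k < 2^q, then k * 4^q < 8^q <= 9^q, against the bound. *)
  rewrite leqNgt; apply/negP => kq; move: bound; rewrite !expnM leqNgt => /negP[].
  apply: (@leq_trans (2 ^ q * (2 ^ 2) ^ q)); first by rewrite ltn_pmul2r ?expn_gt0.
  by rewrite -expnMn leq_exp2r //; lia.
apply: (@le_trans _ _ (2 `^ q%:R)).
  apply: ler_powR; first by rewrite ler1n.
  by rewrite mul1r ler_pdivrMl // -natrM ler_nat; lia.
by rewrite powR_mulrn // -natrX ler_nat.
Qed.
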